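(* Let $f\in\mathcal S^0_{\mu_f}(\mathcal X)$ with $\mu_f\ge0$. Let $\{\beta_k\}_{k\ge1}$ be a positive nondecreasing sequence with $\lim_{k\to+\infty}\beta_k=+\infty$, let $\{\alpha_k\}_{k\ge1}$ be a positive sequence, and suppose that $\delta,\gamma>0$ satisfy, for every $k\ge 1$, $$\delta\gamma-1\ge 0,\qquad \delta\beta_{k+1}\le \delta\beta_k+\alpha_k\beta_k .$$ Let $\{(x_k,\lambda_k)\}_{k\ge1}$ be the sequence generated by the Primal-dual Algorithm (defined in the context) and let $(x^*,\lambda^* )\in\Omega$ (so $\Omega\ne\emptyset$). Assume that $\{\epsilon_k\}_{k\ge1}$ is a nonincreasing sequence of nonnegative numbers satisfying $\sum_{k=1}^{+\infty}\alpha_k\epsilon_k<+\infty$ and $\lim_{k\to+\infty}\beta_k\epsilon_k=+\infty$. Let $\bar x^*$ be the optimal solution of minimal norm of the problem. Then $$\liminf_{k\to+\infty}\|x_k-\bar x^*\|=0 .$$ Further, if there exists an integer $K\ge1$ such that the sequence $\{x_k\}_{k\ge K}$ stays in either the open ball $B(0,\|\bar x^*\|)$ or its complement, then $$\lim_{k\to+\infty}\|x_k-\bar x^*\|=0 .$$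
   Context: $\mathcal X,\mathcal Z$ are real Hilbert spaces. The problem is $\min_{x\in\mathcal X}f(x)$ subject to $Ax=b$, where $f:\mathcal X\to\mathbb R\cup\{+\infty\}$ is proper, convex, lower semicontinuous, $A:\mathcal X\to\mathcal Z$ is a continuous linear operator, $b\in\mathcal Z$, and the set of optimal solutions is nonempty; $\bar x^*$ is the metric projection of $0$ onto this set. $\mathcal S^0_\mu(\mathcal X)$ ($\mu\ge0$) is the set of proper, closed, lower semicontinuous convex functions $f$ on $\mathcal X$ such that $f(x_1)-f(x_2)-\langle w,x_1-x_2\rangle\ge\frac\mu2\|x_1-x_2\|^2$ for all $x_1,x_2\in\mathcal X$ and $w\in\partial f(x_2)$ (convex subdifferential). Lagrangian: $\mathcal L(x,\lambda)=f(x)+\langle\lambda,Ax-b\rangle$. Augmented Lagrangian: $\mathcal L_\theta(x,\lambda)=\mathcal L(x,\lambda)+\frac\theta2\|Ax-b\|^2$. $\Omega$ is the set of saddle points: $(x^*,\lambda^* )\in\Omega$ iff $\mathcal L(x^*,\lambda)\le\mathcal L(x^*,\lambda^* )\le\mathcal L(x,\lambda^* )$ for all $(x,\lambda)\in\mathcal X\times\mathcal Z$. Primal-dual Algorithm. Parameters: $\delta>0$, $\gamma>0$, sequences $\alpha_k>0$, $\beta_k>0$, $\epsilon_k\ge0$. Initialize $x_1=x_0=\frac1\gamma Z_1$, $\lambda_1=\lambda_0$. For $k=1,2,\dots$: $\theta_k=(\alpha_k+\delta)\beta_k$, $\eta_{f,k}=\gamma+\frac1{\alpha_k}+\mu_f\delta\beta_k$,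 $\widetilde\lambda_k=\lambda_k-\delta\beta_k(Ax_k-b)$, $\widetilde x_k=x_k+\frac{Z_k-\gamma x_k}{\eta_{f,k}}$, $$x_{k+1}=\arg\min_{x\in\mathcal X}\Big(\mathcal L_{\theta_k}(x,\widetilde\lambda_k)+\frac{\eta_{f,k}}{2\alpha_k\beta_k}\|x-\widetilde x_k\|^2+\frac{\epsilon_k}2\|x\|^2\Big);$$ then $Z_{k+1}=(\gamma+\frac1{\alpha_k})x_{k+1}-\frac1{\alpha_k}x_k$, $Z^\delta_{k+1}=\delta Z_{k+1}+(1-\delta\gamma)x_{k+1}$, $\lambda_{k+1}=\lambda_k+\alpha_k\beta_k(AZ^\delta_{k+1}-b)$. *)

(* Defs.v *)
(* Throughout, R : realType plays the role of the field of real numbers. *)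
From HB Require Import structures.
From mathcomp Require Import all_boot all_order all_algebra.
From mathcomp Require Import all_classical all_reals all_analysis.

Set Implicit Arguments.
Unset Strict Implicit.
Unset Printing Implicit Defensive.

Import Order.TTheory GRing.Theory Num.Theory.
Import numFieldNormedType.Exports.

Local Open Scope classical_set_scope.
Local Open Scope ring_scope.

HB.mixin Record CompleteNormedModule_isHilbert (R : realType) X
    of CompleteNormedModule R X := {
  inner : {dot X for (@idfun R)} ;
  sqr_norm_inner : forall x : X, `|x| ^+ 2 = inner x x
}.

#[short(type="hilbertType")]
HB.structure Definition Hilbert (R : realType) :=
  {X of CompleteNormedModule_isHilbert R X & CompleteNormedModule R X}.

Section ConvexAnalysis.
Context {R : realType} {X : hilbertType R}.
Implicit Types (f : X -> \bar R) (S : set X) (x : X).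
Local Open Scope ereal_scope.

Definition proper_fun f :=
  (forall x, f x != -oo) /\ exists x, f x != +oo.

(* For the functions considered here -oo is not a value, so no sum below is of
   the form +oo + -oo; at the end points of [0, 1], 0 * +oo = 0. *)
Definition convex_fun f := forall (x y : X) (t : R), (0 <= t <= 1)%R ->
  f (t *: x + (1 - t) *: y)%R <= t%:E * f x + (1 - t)%:E * f y.

Definition closed_fun f := closed [set p : X * R | f p.1 <= p.2%:E].

Definition subdiff f x : set X :=
  [set w | forall y, f x + (inner w (y - x))%:E <= f y].

(* S^0_mu.  When f is proper, w \in subdiff f x2 forces f x2 to be finite, so
   the difference f x1 - f x2 is meaningful (possibly +oo). *)
Definition S0 (mu : R) f :=
  [/\ proper_fun f, closed_fun f, lower_semicontinuous f, convex_fun f &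
      forall x1 x2 w, subdiff f x2 w ->
        (mu / 2 * `|x1 - x2| ^+ 2)%:E <= f x1 - f x2 - (inner w (x1 - x2))%:E].

Definition argmin (g : X -> \bar R) : set X := [set x | forall y, g x <= g y].

Definition metric_projection S (z p : X) :=
  S p /\ forall y, S y -> (`|z - p| <= `|z - y|)%R.

End ConvexAnalysis.

Section Problem.
Context {R : realType} {X Z : hilbertType R}.
Variables (f : X -> \bar R) (A : {linear X -> Z}) (b : Z).
Local Open Scope ereal_scope.

(* Optimal solutions of  min f(x)  subject to  A x = b. *)
Definition solutions : set X :=
  [set x | [/\ A x = b, f x < +oo & forall y, A y = b -> f x <= f y]].

Definition lagrangian (x : X) (lambda : Z) : \bar R :=
  f x + (inner lambda (A x - b))%:E.

Definition aug_lagrangian (theta : R) (x : X) (lambda : Z) : \bar R :=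
  lagrangian x lambda + (theta / 2 * `|A x - b| ^+ 2)%:E.

Definition saddle_points : set (X * Z) :=
  [set p | forall (x : X) (lambda : Z),
     lagrangian p.1 lambda <= lagrangian p.1 p.2 /\
     lagrangian p.1 p.2 <= lagrangian x p.2].

End Problem.

Section Algorithm.
Context {R : realType} {X Y : hilbertType R}.
Variables (f : X -> \bar R) (A : {linear X -> Y}) (b : Y).
Variables (muf delta gamma : R) (alpha beta eps : nat -> R).
Variables (x Z : nat -> X) (lambda : nat -> Y).

Definition theta_ k := (alpha k + delta) * beta k.

Definition eta_ k := gamma + (alpha k)^-1 + muf * delta * beta k.

Definition lambda_tilde k := lambda k - (delta * beta k) *: (A (x k) - b).

Definition x_tilde k := x k + (eta_ k)^-1 *: (Z k - gamma *: x k).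

Definition subproblem k (u : X) : \bar R :=
  (aug_lagrangian f A b (theta_ k) u (lambda_tilde k)
   + (eta_ k / (2 * alpha k * beta k) * `|u - x_tilde k| ^+ 2)%:E
   + (eps k / 2 * `|u| ^+ 2)%:E)%E.

(* Z_delta k stands for Z^delta_k; it is only used at indices k >= 2. *)
Definition Z_delta k := delta *: Z k + (1 - delta * gamma) *: x k.

(* The parameters are indexed from 1; alpha 0, beta 0, eps 0 and Z 0 play no role. *)
Definition primal_dual_algorithm :=
  [/\ x 1%N = x 0%N, x 0%N = gamma^-1 *: Z 1%N, lambda 1%N = lambda 0%N &
    forall k, (1 <= k)%N ->
      [/\ argmin (subproblem k) (x k.+1),
          Z k.+1 = (gamma + (alpha k)^-1) *: x k.+1 - (alpha k)^-1 *: x k &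
          lambda k.+1
          = lambda k + (alpha k * beta k) *: (A (Z_delta k.+1) - b)]].

End Algorithm.

(* Main.v *)
(* Write h(u) = L(u, lambda* ) - f(xbar) >= 0.  Along the iterates the energy
     delta^2 beta_k h(x_k) + |Z^delta_k - xbar|^2/2
       + (delta gamma - 1)/2 |x_k - xbar|^2 + delta/2 |lambda_k - lambda*|^2
       + delta^2 mu_f beta_k/2 |x_k - xbar|^2,
   augmented by delta^2 beta_k eps_k/2 (|x_k|^2 - r), increases at step k by at
   most delta/2 alpha_k beta_k eps_k (|xbar|^2 - r) as soon as |x_(k+1)|^2 >= r.
   With r = 0 and Kronecker's lemma the energy is o(beta_k), so h(x_k) -> 0 and
   A x_k -> b.  With r = |xbar|^2, while the iterates stay outside the ball, it
   is nonincreasing, so beta_k eps_k -> oo forces |x_k| -> |xbar|.  Finally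
   h(x_k) -> 0, A x_k -> b and limsup |x_k| <= |xbar| imply x_k -> xbar: the
   sets {h <= d, |Au - b| <= d, |u|^2 <= |xbar|^2 + d} are closed, convex and
   nested, and a parallelogram argument replaces weak compactness. *)
Require Import Defs.
From mathcomp Require Import all_boot all_order all_algebra.
From mathcomp Require Import all_classical all_reals all_analysis.
From mathcomp Require Import ring lra.

Set Implicit Arguments.
Unset Strict Implicit.
Unset Printing Implicit Defensive.

Import Order.TTheory GRing.Theory Num.Theory.
Import numFieldNormedType.Exports.

Local Open Scope classical_set_scope.
Local Open Scope ring_scope.

(** * Inner product identities and minimal-norm points of nested convex sets *)

Section Hilbert.
Context {R : realType} {X : hilbertType R}.
Implicit Types (u v w x y : X) (a : R).

Lemma innerC u v : inner u v = inner v u.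
Proof. by rewrite hermC /= expr0 mul1r. Qed.

Lemma innerDl w : {morph (fun u => inner u w) : u v / u + v}.
Proof. by move=> u v /=; rewrite linearDl. Qed.

Lemma innerNl w : {morph (fun u => inner u w) : u / - u}.
Proof. by move=> u /=; rewrite linearNl. Qed.

Lemma innerBl w : {morph (fun u => inner u w) : u v / u - v}.
Proof. by move=> u v /=; rewrite linearBl. Qed.

Lemma innerZl w a : {morph (fun u => inner u w) : u / a *: u >-> a * u}.
Proof. by move=> u /=; rewrite linearZl_LR. Qed.

Lemma innerDr w : {morph inner w : u v / u + v}.
Proof. by move=> u v; rewrite !(innerC w) innerDl. Qed.

Lemma innerNr w : {morph inner w : u / - u}.
Proof. by move=> u; rewrite !(innerC w) innerNl. Qed.

Lemma innerBr w : {morph inner w : u v / u - v}.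
Proof. by move=> u v; rewrite !(innerC w) innerBl. Qed.

Lemma innerZr w a : {morph inner w : u / a *: u >-> a * u}.
Proof. by move=> u; rewrite !(innerC w) innerZl. Qed.

Lemma inner0l w : inner 0 w = 0.
Proof. by rewrite linear0l. Qed.

Lemma inner0r w : inner w 0 = 0.
Proof. by rewrite innerC inner0l. Qed.

Definition innerE := (innerDl, innerDr, innerNl, innerNr, innerZl, innerZr).

(** Reduces vector identities to scalar ones, which [ring] and [field] can settle. *)
Lemma inner_inj u v : (forall w, inner u w = inner v w) -> u = v.
Proof.
move=> uv; apply/eqP; rewrite -subr_eq0 -normr_eq0 -sqrf_eq0.
by rewrite sqr_norm_inner innerBl uv -innerBl subrr inner0l.
Qed.

Lemma sqr_normD u v : `|u + v| ^+ 2 = `|u| ^+ 2 + 2 * inner u v + `|v| ^+ 2.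
Proof. by rewrite !sqr_norm_inner !innerE (innerC v u); ring. Qed.

Lemma sqr_normB u v : `|u - v| ^+ 2 = `|u| ^+ 2 - 2 * inner u v + `|v| ^+ 2.
Proof. by rewrite sqr_normD innerNr normrN; ring. Qed.

Lemma sqr_normZ a u : `|a *: u| ^+ 2 = a ^+ 2 * `|u| ^+ 2.
Proof. by rewrite normrZ exprMn -normrX ger0_norm ?sqr_ge0. Qed.

Lemma sqr_norm_half u v :
  `|2^-1 *: (u + v)| ^+ 2 =
  `|u| ^+ 2 / 2 + `|v| ^+ 2 / 2 - `|u - v| ^+ 2 / 4.
Proof. by rewrite sqr_normZ sqr_normD sqr_normB; field. Qed.

(** Cauchy-Schwarz: the squared norm of |v| u - |u| v expands to 2 |u| |v| (|u| |v| - <u, v>). *)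
Lemma inner_le_norm u v : inner u v <= `|u| * `|v|.
Proof.
have [->|u0] := eqVneq u 0; first by rewrite inner0l normr0 mul0r.
have [->|v0] := eqVneq v 0; first by rewrite inner0r normr0 mulr0.
have nu : 0 < `|u| by rewrite normr_gt0.
have nv : 0 < `|v| by rewrite normr_gt0.
have := sqr_ge0 (`| `|v| *: u - `|u| *: v |).
rewrite sqr_normB !sqr_normZ innerZl innerZr => h.
have {}h : 0 <= (2 * (`|u| * `|v|)) * (`|u| * `|v| - inner u v) by nra.
by rewrite -subr_ge0 -(pmulr_rge0 _ (_ : 0 < 2 * (`|u| * `|v|)))// !mulr_gt0.
Qed.

Lemma ler_norm_inner u v : `|inner u v| <= `|u| * `|v|.
Proof.
rewrite ler_norml inner_le_norm andbT lerNl -innerNl.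
by rewrite (le_trans (inner_le_norm _ _))// normrN.
Qed.

Lemma inner_continuous w : continuous (inner w).
Proof.
move=> u; apply/cvgrPdist_le => e e0.
have w1 : 0 < `|w| + 1 by rewrite ltr_wpDl.
near=> v; rewrite -innerBr (le_trans (ler_norm_inner _ _))//.
rewrite (@le_trans _ _ ((`|w| + 1) * `|u - v|)) ?ler_wpM2r ?lerDl//.
rewrite -ler_pdivlMl// mulrC ltW//.
have : ball u (e / (`|w| + 1)) v; last by rewrite -ball_normE.
by near: v; apply: nbhsx_ballx; rewrite divr_gt0.
Unshelve. all: by end_near. Qed.

(* The square norms of near-minimisers differ little from the supremum [s] of
   the lower bounds available on the sets [C n], so the parallelogram identity
   makes them a Cauchy sequence. *)
Lemma nested_min_norm (C : nat -> set X) (M : R) :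
  (forall n, closed (C n)) ->
  (forall n m, (n <= m)%N -> C m `<=` C n) ->
  (forall n u v, C n u -> C n v -> C n (2^-1 *: (u + v))) ->
  (forall n, exists2 u, C n u & `|u| ^+ 2 <= M) ->
  exists p, (forall n, C n p) /\
    forall e, 0 < e ->
      exists n, forall u, C n u -> `|p| ^+ 2 - e <= `|u| ^+ 2.
Proof.
move=> Ccl Cnest Cmid CM.
pose S := [set r : R | exists n, forall u, C n u -> r <= `|u| ^+ 2].
have S0 : S !=set0 by exists 0, 0%N => u _; rewrite sqr_ge0.
have SM : ubound S M.
  by move=> r [n hn]; have [u Cu uM] := CM n; exact: le_trans (hn u Cu) uM.
have supS : has_sup S by split => //; exists M.
pose s := sup S.
have lo (e : R) : 0 < e -> exists n, forall u, C n u -> s - e <= `|u| ^+ 2.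
  move=> e0; have [r [n rn] sr] := sup_adherent e0 supS.
  by exists n => u Cu; rewrite (le_trans (ltW sr))// rn.
have hi (e : R) n : 0 < e -> exists2 u, C n u & `|u| ^+ 2 <= s + e.
  (* Otherwise [s + e] would itself be a lower bound on [C n], hence an element of [S] above its
     supremum. *)
  move=> e0; apply: contrapT => h.
  have : S (s + e).
    exists n => u Cu; rewrite leNgt; apply/negP => ue.
    by apply: h; exists u => //; exact: ltW.
  by move/(ub_le_sup (proj2 supS)); rewrite -/s gerDl leNgt e0.
pose e_ (k : nat) : R := k.+1%:R^-1.
have e_gt0 k : 0 < e_ k by rewrite invr_gt0.
have /choice[Np Np_] k : exists np : nat * X,
    [/\ (k <= np.1)%N, C np.1 np.2, `|np.2| ^+ 2 <= s + e_ k &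
        forall u, C np.1 u -> s - e_ k <= `|u| ^+ 2].
  have [n nlo] := lo _ (e_gt0 k).
  have [u Cu us] := hi _ (maxn n k) (e_gt0 k).
  exists (maxn n k, u); split => //=; first exact: leq_maxr.
  by move=> v /Cnest-/(_ _ (leq_maxl n k)) /nlo.
(* The midpoint lies in the larger of the two sets. With E the larger tolerance and N the squared
   distance, the parallelogram identity gives s - E <= s + E - N / 4. *)
have close i j : `|(Np i).2 - (Np j).2| ^+ 2 <= 8 * Num.max (e_ i) (e_ j).
  have [_ Ci ui li] := Np_ i; have [_ Cj uj lj] := Np_ j.
  have : s - Num.max (e_ i) (e_ j)
      <= `|2^-1 *: ((Np i).2 + (Np j).2)| ^+ 2.
    have [ij|/ltnW ji] := leqP (Np i).1 (Np j).1.
    - have /li : C (Np i).1 (2^-1 *: ((Np i).2 + (Np j).2)).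
        by apply: Cmid => //; exact: Cnest Cj.
      by apply: le_trans; rewrite lerD2l lerN2 le_max lexx.
    - have /lj : C (Np j).1 (2^-1 *: ((Np i).2 + (Np j).2)).
        by apply: Cmid => //; exact: Cnest Ci.
      by apply: le_trans; rewrite lerD2l lerN2 le_max lexx orbT.
  rewrite sqr_norm_half.
  have : e_ i <= Num.max (e_ i) (e_ j) by rewrite le_max lexx.
  have : e_ j <= Num.max (e_ i) (e_ j) by rewrite le_max lexx orbT.
  by set E := Num.max _ _; set N := `|_ - _| ^+ 2; lra.
have e_le i j : (i <= j)%N -> e_ j <= e_ i.
  by move=> ij; rewrite lef_pV2 ?posrE// ler_nat.
have /cauchy_cvg/cvg_ex[p pcvg] : cauchy ((fun k => (Np k).2) @ \oo).
  apply: cauchy_exP => e e0.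
  have /ltr_add_invr[k] : 0 < e ^+ 2 / 8 by rewrite divr_gt0// exprn_gt0.
  rewrite add0r => ke; exists (Np k).2; exists k => // j /= kj.
  rewrite -ball_normE /= -(ltr_pXn2r (ltn0Sn 1)) ?nnegrE// ?ltW//.
  rewrite (le_lt_trans (close _ _))// (max_idPl (e_le _ _ kj)).
  by rewrite -ltr_pdivlMl// mulrC.
exists p; split=> [n|e e0].
  apply: (closed_cvg (C n)) pcvg => //.
  exists n => // k /= nk; have [kN Ck _ _] := Np_ k.
  exact: Cnest (leq_trans nk kN) _ Ck.
have ps : `|p| ^+ 2 <= s.
  apply/ler_addgt0Pr => e1 e10.
  have cvp : `|(Np k).2| * `|(Np k).2| @[k --> \oo] --> `|p| * `|p|.
    by apply: cvgM; exact: cvg_norm.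
  rewrite expr2.
  apply: (cvgr_to_le cvp); have [k] := ltr_add_invr e10.
  rewrite add0r => ke; exists k => // j /= kj.
  rewrite -expr2; have [_ _ + _] := Np_ j => /le_trans; apply.
  by rewrite lerD2l (le_trans (e_le _ _ kj))// ltW.
by have [n nlo] := lo e e0; exists n => u /nlo; apply: le_trans; rewrite lerD2r.
Qed.

(** The point [q] given by [nested_min_norm] lies in every [C n], so |p| <= |q| and the lower bounds
    close to |q|^2 serve for |p|^2 as well. The midpoint of [u] and [p] then turns closeness of
    norms into closeness of points. *)
Lemma min_norm_well_posed (C : nat -> set X) p :
  (forall n, closed (C n)) ->
  (forall n m, (n <= m)%N -> C m `<=` C n) ->
  (forall n u v, C n u -> C n v -> C n (2^-1 *: (u + v))) ->
  (forall n, C n p) ->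
  (forall u, (forall n, C n u) -> `|p| <= `|u|) ->
  (forall n u, C n u -> `|u| ^+ 2 <= `|p| ^+ 2 + n.+1%:R^-1) ->
  forall e, 0 < e -> exists n, forall u, C n u -> `|u - p| < e.
Proof.
move=> Ccl Cnest Cmid Cp pmin Cle e e0.
have [q [Cq qlo]] : exists q, (forall n, C n q) /\
    forall e, 0 < e -> exists n, forall u, C n u -> `|q| ^+ 2 - e <= `|u| ^+ 2.
  by apply: (nested_min_norm Ccl Cnest Cmid) => n; exists p; [exact: Cp|exact: lexx].
have pq : `|p| ^+ 2 <= `|q| ^+ 2 by rewrite lerXn2r ?nnegrE// pmin.
(* With this tolerance on both sides, the parallelogram identity bounds the squared distance by 6/8
   of [e ^+ 2]. *)
have d0 : 0 < e ^+ 2 / 8 by rewrite divr_gt0// exprn_gt0.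
have [n nlo] := qlo _ d0.
have [k] := ltr_add_invr d0; rewrite add0r => kd.
exists (maxn n k) => u Cu.
rewrite -(ltr_pXn2r (ltn0Sn 1)) ?nnegrE// ?ltW//.
have /nlo : C n (2^-1 *: (u + p)).
  by apply: Cmid => //; exact: Cnest (leq_maxl n k) _ Cu.
have := Cle _ _ (Cnest _ _ (leq_maxr n k) _ Cu).
rewrite sqr_norm_half; move: (k.+1%:R^-1) kd => d kd.
by set N := `|_ - _| ^+ 2; lra.
Qed.

End Hilbert.

(** * Adjoint vectors by Riesz representation *)

Section Adjoint.
Context {R : realType} {X Y : hilbertType R}.

(** A nonzero functional is represented by a multiple of the minimal-norm point [p] of its level set
    at 1, because [p] is orthogonal to the kernel. The constant sequence of sets in
    [nested_min_norm] provides [p]. *)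
Lemma adjoint_exists (A : {linear X -> Y}) (m : Y) : continuous A ->
  exists w : X, forall u, inner w u = inner m (A u).
Proof.
move=> Ac; have [m0|/existsNP[u0 /eqP mu0]] :=
  pselect (forall u, inner m (A u) = 0).
  by exists 0 => u; rewrite inner0l m0.
pose C := [set u | inner m (A u) = 1].
have Ccl : closed C.
  apply: (@closed_comp _ _ (fun u => inner m (A u)) [set 1]) => [u _|].
    by apply: continuous_comp; [exact: Ac|exact: inner_continuous].
  exact: closed_eq.
have [p [/(_ 0%N) Cp plo]] : exists p, (forall n : nat, C p) /\
    forall e, 0 < e ->
      exists n : nat, forall u, C u -> `|p| ^+ 2 - e <= `|u| ^+ 2.
  pose u1 := (inner m (A u0))^-1 *: u0.
  apply: (@nested_min_norm _ _ (fun=> C) (`|u1| ^+ 2)) => //.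
  - by move=> n k _; exact: subset_refl.
  - by move=> _ u v Cu Cv; rewrite /C /= linearZ linearD !innerE Cu Cv; field.
  - by move=> n; exists u1 => //; rewrite /C /= linearZ innerZr mulVf.
have pmin u : C u -> `|p| ^+ 2 <= `|u| ^+ 2.
  move=> Cu; apply/ler_addgt0Pr => e e0; have [_ /(_ _ Cu)] := plo e e0.
  by rewrite lerBlDr.
have port z : inner m (A z) = 0 -> inner p z = 0.
  (* The competitor p - a z / (b + 1) has squared norm |p|^2 - a^2 (b + 2) / (b + 1)^2, which
     contradicts minimality unless a = 0. The added 1 covers z = 0. *)
  move=> mz; set a := inner p z; set b := `|z| ^+ 2.
  have b1 : 0 < b + 1 by rewrite ltr_wpDl// sqr_ge0.
  have : C (p + (- a / (b + 1)) *: z).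
    by rewrite /C /= linearD linearZ innerDr innerZr mz mulr0 addr0.
  move/pmin; rewrite sqr_normD innerZr sqr_normZ -/a -/b.
  rewrite -addrA lerDl => h.
  have : 0 <= (b + 1) ^+ 2 * (2 * (- a / (b + 1) * a) + (- a / (b + 1)) ^+ 2 * b).
    by rewrite mulr_ge0// sqr_ge0.
  have -> : (b + 1) ^+ 2 * (2 * (- a / (b + 1) * a) + (- a / (b + 1)) ^+ 2 * b)
     = - (b + 2) * a ^+ 2 by field; rewrite gt_eqF.
  rewrite mulNr oppr_ge0 pmulr_rle0 ?ltr_wpDl ?sqr_ge0//.
  by move=> a2; apply/eqP; rewrite -sqrf_eq0 eq_le a2 sqr_ge0.
have p0 : `|p| ^+ 2 != 0.
  rewrite sqrf_eq0 normr_eq0; apply/eqP => p0.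
  by move: Cp; rewrite /C /= p0 linear0 inner0r => /esym/eqP; rewrite oner_eq0.
exists (`|p| ^- 2 *: p) => u; rewrite innerZl.
have : inner p (u - inner m (A u) *: p) = 0.
  apply: port; rewrite linearB linearZ innerBr innerZr.
  by move: Cp; rewrite /C /= => ->; rewrite mulr1 subrr.
rewrite innerBr innerZr -sqr_norm_inner => /eqP; rewrite subr_eq0 => /eqP ->.
by rewrite mulrC mulfK.
Qed.

End Adjoint.

(** * Convexity and closedness of extended-real functions *)

Section Convex.
Context {R : realType} {X : hilbertType R}.
Implicit Types (f : X -> \bar R) (u v : X).

Lemma convex_fun_le f u v (t a b : R) : convex_fun f -> 0 <= t <= 1 ->
  (f u <= a%:E)%E -> (f v <= b%:E)%E ->
  (f (t *: u + (1 - t) *: v)%R <= (t * a + (1 - t) * b)%:E)%E.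
Proof.
move=> fc t01 fu fv; apply: (le_trans (fc u v t t01)).
have /andP[t0 t1] := t01.
by rewrite [leRHS]EFinD !EFinM leeD// lee_wpmul2l// lee_fin ?subr_ge0.
Qed.

(** The set is the preimage of the closed epigraph of [f] under [u |-> (u, r - g u)]. *)
Lemma closed_sublevel f (g : X -> R) (r : R) : closed_fun f -> continuous g ->
  closed [set u | (f u + (g u)%:E <= r%:E)%E].
Proof.
move=> fcl gc.
have -> : [set u | (f u + (g u)%:E <= r%:E)%E] =
    (fun u => (u, r - g u)) @^-1` [set p : X * R | (f p.1 <= p.2%:E)%E].
  by apply/seteqP; split => u /=; rewrite EFinB leeBrDr.
have gc' : continuous (fun u => r - g u).
  by move=> u; apply: cvgB; [exact: cvg_cst|exact: gc].
apply: closed_comp fcl => u _.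
exact: (@cvg_pair _ _ _ _ _ _ _ _ _ id _ (@cvg_id _ (nbhs u)) (gc' u)).
Qed.

End Convex.

(** * Tails of series, weighted growth and lower limits *)

Section RealSequences.
Context {R : realType}.
Implicit Types (a beta G : nat -> R).

(** Partial sums are bounded by the value of the series; once they are within [e] of their supremum,
    no later block can exceed [e]. *)
Lemma summable_tail_le a K : (forall k, (K <= k)%N -> 0 <= a k) ->
  (\sum_(K <= k <oo) (a k)%:E < +oo)%E ->
  forall e, 0 < e -> exists2 N, (K <= N)%N &
    forall k, (N <= k)%N -> \sum_(N <= j < k) a j <= e.
Proof.
move=> a0 alty e e0; pose S := range (fun n => \sum_(K <= j < n) a j).
have M_ge n : ((\sum_(K <= j < n) a j)%:E <= \sum_(K <= k <oo) (a k)%:E)%E.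
  rewrite -sumEFin; apply: nneseries_lim_ge => k Kk _.
  by rewrite lee_fin a0.
have supS : has_sup S.
  split; first by exists (\sum_(K <= j < 0) a j), 0%N.
  exists (fine (\sum_(K <= k <oo) (a k)%:E)%E) => _ [n _ <-].
  rewrite -lee_fin fineK// ge0_fin_numE//.
  by rewrite (le_trans _ (M_ge 0%N))// big_geq.
have [_ [n _ <-] nlt] := sup_adherent e0 supS.
exists (maxn n K); first exact: leq_maxr.
move=> k nk; have Kk := leq_trans (leq_maxr n K) nk.
have : \sum_(K <= j < k) a j <= sup S by apply: ub_le_sup (proj2 supS) _ _; exists k.
rewrite (@big_cat_nat _ _ _ (maxn n K))//= ?leq_maxr//.
have : \sum_(K <= j < n) a j <= \sum_(K <= j < maxn n K) a j.
  by have [nK|//] := leqP n K; rewrite !big_geq.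
by move: nlt; set s := sup _; set A := \sum_(K <= j < n) _;
  set B := \sum_(K <= j < maxn n K) _; set C := \sum_(_ <= j < k) _; lra.
Qed.

(* A form of Kronecker's lemma. *)
Lemma weighted_growth_little_o a beta G K :
  (forall k, (K <= k)%N -> 0 <= a k) ->
  (\sum_(K <= k <oo) (a k)%:E < +oo)%E ->
  (forall k, (K <= k)%N -> 0 <= beta k) ->
  (forall k, (K <= k)%N -> beta k <= beta k.+1) ->
  beta k @[k --> \oo] --> +oo ->
  (forall k, (K <= k)%N -> G k.+1 <= G k + beta k * a k) ->
  forall e, 0 < e -> \forall k \near \oo, G k <= e * beta k.
Proof.
move=> a0 alty b0 bnd boo GS e e0.
have e2 : 0 < e / 2 by rewrite divr_gt0.
have [N KN tail] := summable_tail_le a0 alty e2.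
(* By monotonicity each weight is replaced by the last one. The tail sum then costs half of [e], and
   [G N], a constant, the other half. *)
have GN n : G (N + n)%N <=
    G N + beta (N + n)%N * \sum_(N <= j < N + n) a j.
  elim: n => [|n IH]; first by rewrite addn0 big_geq// mulr0 addr0.
  have KNn : (K <= N + n)%N by rewrite (leq_trans KN)// leq_addr.
  rewrite addnS (le_trans (GS _ KNn))// big_nat_recr ?leq_addr//=.
  have s0 : 0 <= \sum_(N <= j < N + n) a j.
    rewrite big_nat_cond sumr_ge0// => j /andP[/andP[Nj _] _].
    by rewrite a0// (leq_trans KN).
  rewrite mulrDr addrA lerD//; last by rewrite ler_wpM2r ?a0 ?bnd.
  by rewrite (le_trans IH)// lerD2l ler_wpM2r// bnd.
near=> k.
have Nk : (N <= k)%N by near: k; exact: nbhs_infty_ge.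
have := GN (k - N)%N; rewrite subnKC// => /le_trans; apply.
have bk : G N / (e / 2) <= beta k.
  by near: k; move/cvgryPge : boo; apply.
move: bk; rewrite ler_pdivrMr// => bk.
have : beta k * \sum_(N <= j < k) a j <= beta k * (e / 2).
  by rewrite ler_wpM2l ?tail// b0// (leq_trans KN).
lra.
Unshelve. all: by end_near. Qed.

(** Every tail already has infimum 0, so the sequence of tail infima is constant. *)
Lemma limn_einf_eq0 (u : nat -> R) : (forall k, 0 <= u k) ->
  (forall e, 0 < e -> forall N, exists2 k, (N <= k)%N & u k < e) ->
  limn_einf (fun k => (u k)%:E) = 0%E.
Proof.
move=> u0 uinf; rewrite limn_einf_lim.
have -> : einfs (fun k => (u k)%:E) = cst 0%E.
  apply/funext => n; rewrite /einfs/=; apply/eqP; rewrite eq_le; apply/andP; split.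
    apply/lee_addgt0Pr => e e0; rewrite add0e.
    have [k nk uk] := uinf e e0 n.
    by apply: ereal_inf_le; exists (u k)%:E; [exists k|rewrite lee_fin ltW].
  by apply: le_ereal_inf_tmp => _ [k /= _ <-]; rewrite lee_fin.
exact: lim_cst.
Qed.

End RealSequences.

(** The recursion says that s - l at [k.+1] equals tau (s - l) at [k] minus (1 - tau) l at [k.+1].
    Such an average keeps |s - l| below |s K - l K| + D; returning to [s] costs a second [D]. *)
Lemma averaging_bound {R : realType} {V : normedModType R}
    (s l : nat -> V) (tau D : nat -> R) (K : nat) :
  (forall k, (K <= k)%N -> 0 <= tau k <= 1) ->
  (forall k, (K <= k)%N -> D k <= D k.+1) ->
  (forall k, (K <= k)%N -> `|l k| <= D k) ->
  (forall k, (K <= k)%N -> s k.+1 = tau k *: (s k + (l k.+1 - l k))) ->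
  forall k, (K <= k)%N -> `|s k| <= `|s K - l K| + 2 * D k.
Proof.
move=> tau01 Dnd lD sS k /subnKC <-; set n := (k - K)%N.
have D0 i : (K <= i)%N -> 0 <= D i by move/lD; exact: le_trans.
have main m : `|s (K + m)%N - l (K + m)%N| <= `|s K - l K| + D (K + m)%N.
  elim: m => [|m IH]; first by rewrite addn0 lerDl D0.
  have Km : (K <= K + m)%N by exact: leq_addr.
  have KSm : (K <= (K + m).+1)%N by exact: leqW.
  have /andP[t0 t1] := tau01 _ Km.
  rewrite addnS sS//; set i := (K + m)%N in IH Km KSm t0 t1 *.
  have -> : tau i *: (s i + (l i.+1 - l i)) - l i.+1 =
      tau i *: (s i - l i) - (1 - tau i) *: l i.+1.
    rewrite !scalerDr !scalerN scalerBl scale1r opprB !addrA addrAC.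
    by congr (_ - _); rewrite -!addrA; congr (_ + _); rewrite addrC.
  rewrite (le_trans (ler_normB _ _))// !normrZ (ger0_norm t0).
  rewrite ger0_norm ?subr_ge0//.
  have h1 : tau i * `|s i - l i| <= tau i * (`|s K - l K| + D i.+1).
    by rewrite ler_wpM2l// (le_trans IH)// lerD2l Dnd.
  have h2 : (1 - tau i) * `|l i.+1| <= (1 - tau i) * (`|s K - l K| + D i.+1).
    rewrite ler_wpM2l ?subr_ge0// (le_trans (lD _ KSm))//.
    by rewrite lerDr.
  by lra.
have Kn : (K <= K + n)%N by exact: leq_addr.
have -> : s (K + n)%N = (s (K + n)%N - l (K + n)%N) + l (K + n)%N by rewrite subrK.
rewrite (le_trans (ler_normD _ _))//.
by have := main n; have := lD _ Kn; lra.
Qed.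

(** * First-order optimality under a quadratic perturbation *)

Section Optimality.
Context {R : realType} {X : hilbertType R}.
Implicit Types (f : X -> \bar R).

(** Fermat's rule, with [w] the gradient of [q] at [p]. A move by [t] towards [y] changes [f] by at
    most t (f y - f p); after division by [t] only the error [t * Q d] remains. *)
Lemma argmin_add_quadratic f (q : X -> R) (Q : X -> R) p w :
  proper_fun f -> convex_fun f ->
  (forall d t, q (p + t *: d) = q p + t * inner w d + t ^+ 2 * Q d) ->
  argmin (fun u => f u + (q u)%:E)%E p ->
  f p \is a fin_num /\ subdiff f p (- w).
Proof.
move=> [fNy [y0 fy0]] fconv qE pmin.
have fpfin : f p \is a fin_num.
  rewrite fin_numE fNy/=; apply/eqP => fpy; move/eqP: fy0; apply.
  have := pmin y0; rewrite fpy addye// leye_eq => /eqP.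
  by case: (f y0) (fNy y0).
split=> // y; move: (fNy y); case fyE : (f y) => [r| |]// _; last first.
  by rewrite leey.
rewrite -(fineK fpfin); set m := fine (f p).
rewrite -EFinD lee_fin innerNl; apply/ler_addgt0Pr => e e0.
(* The bound 1 allows convexity to be used, the other one makes [t * Q d] at most [e]; adding 1
   keeps the denominator positive. *)
set d := y - p; pose t := Num.min 1 (e / (`|Q d| + 1)).
have Q1 : 0 < `|Q d| + 1 by rewrite ltr_wpDl.
have t0 : 0 < t by rewrite lt_min ltr01 divr_gt0.
have t1 : t <= 1 by rewrite ge_min lexx.
have tQ : t * Q d <= e.
  rewrite (@le_trans _ _ (t * (`|Q d| + 1)))//.
    by rewrite ler_wpM2l ?(ltW t0)// (le_trans (ler_norm _))// lerDl.
  by rewrite -ler_pdivlMr// ge_min lexx orbT.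
have fconvt : (f (p + t *: d)%R <= (t * r + (1 - t) * m)%:E)%E.
  have -> : p + t *: d = t *: y + (1 - t) *: p.
    by rewrite /d scalerBr scalerBl scale1r addrCA.
  apply: convex_fun_le => //; first by rewrite (ltW t0).
  - by rewrite fyE.
  - by rewrite /m fineK.
have := le_trans (pmin (p + t *: d)) (leeD fconvt (lexx _)).
rewrite -(fineK fpfin) -/m qE -!EFinD lee_fin => h.
have : 0 <= t * (r - m + inner w d + t * Q d) by move: h; lra.
by rewrite pmulr_rge0//; lra.
Qed.

End Optimality.

(** * Saddle points and well-posedness of the minimal-norm solution *)

Section SaddlePoint.
Context {R : realType} {X Y : hilbertType R}.
Variables (f : X -> \bar R) (A : {linear X -> Y}) (b : Y).
Hypotheses (f_proper : proper_fun f).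

(** The point [xs] is feasible, so f xbar <= f xs = L(xs, ls) <= L(u, ls). *)
Lemma saddle_point_lower_bound (xs : X) (ls : Y) (xbar : X) :
  saddle_points f A b (xs, ls) -> solutions f A b xbar ->
  f xbar \is a fin_num /\ forall u, (f xbar <= lagrangian f A b u ls)%E.
Proof.
have [fNy _] := f_proper.
move=> sad [Axb fxb xbmin].
have fbfin : f xbar \is a fin_num by rewrite fin_numE fNy/= -ltey.
split=> // u.
have [_] := sad xbar ls; rewrite /= /lagrangian Axb subrr inner0r adde0 => sxb.
have fsfin : f xs \is a fin_num.
  rewrite fin_numE fNy/=; apply/eqP => fsy.
  by move: sxb; rewrite fsy addye// leye_eq => /eqP fy; rewrite fy in fxb.
(* Moving the multiplier along the residual itself raises the Lagrangian by |A xs - b|^2, which the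
   saddle inequality forces to be 0. *)
have Axs : A xs = b.
  have [+ _] := sad xs (ls + (A xs - b)).
  rewrite /= /lagrangian leeD2lE// lee_fin innerDl gerDl -sqr_norm_inner.
  move=> h; apply/eqP; rewrite -subr_eq0 -normr_eq0 -sqrf_eq0.
  by rewrite eq_le h sqr_ge0.
have [_] := sad u ls; rewrite /= {1}/lagrangian Axs subrr inner0r adde0.
exact/le_trans/xbmin.
Qed.

(** A point common to all the sets [C n] is feasible with value at most [f xbar], hence a solution,
    so the projection property makes [xbar] the minimal-norm point required by
    [min_norm_well_posed]. *)
Lemma min_norm_solution_well_posed (ls : Y) (xbar : X) :
  continuous A -> closed_fun f -> convex_fun f ->
  f xbar \is a fin_num ->
  (forall u, (f xbar <= lagrangian f A b u ls)%E) ->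
  metric_projection (solutions f A b) 0 xbar ->
  forall e, 0 < e -> exists2 d, 0 < d & forall u,
    (lagrangian f A b u ls <= f xbar + d%:E)%E -> `|A u - b| <= d ->
    `|u| ^+ 2 <= `|xbar| ^+ 2 + d -> `|u - xbar| < e.
Proof.
move=> Ac fcl fconv fbfin flb [[Axb fxb xbmin] xbproj] e e0.
pose c := fine (f xbar); have fbE : f xbar = c%:E by rewrite fineK.
pose e_ (n : nat) : R := n.+1%:R^-1.
pose C n := [set u | [/\ (lagrangian f A b u ls <= (c + e_ n)%:E)%E,
  `|A u - b| <= e_ n & `|u| ^+ 2 <= `|xbar| ^+ 2 + e_ n]].
have e_le n m : (n <= m)%N -> e_ m <= e_ n.
  by move=> nm; rewrite lef_pV2 ?posrE// ler_nat.
have e_gt0 n : 0 < e_ n by rewrite invr_gt0.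
have Abc : continuous (fun u => A u - b).
  by move=> u; apply: cvgB; [exact: Ac|exact: cvg_cst].
have lc : continuous (fun u => inner ls (A u - b)).
  move=> u; apply: (@continuous_comp _ _ _ (fun u => A u - b) (inner ls)).
    exact: Abc.
  exact: inner_continuous.
have small (a : R) : 0 <= a -> (forall n, a <= e_ n) -> a = 0.
  move=> a0 ae; apply/eqP; rewrite eq_le a0 andbT; apply/ler_addgt0Pr => r r0.
  have [n] := ltr_add_invr r0; rewrite !add0r => nr.
  exact: le_trans (ae n) (ltW nr).
have [n nball] : exists n, forall u, C n u -> `|u - xbar| < e.
  apply: min_norm_well_posed => //.
  - move=> n.
    have -> : C n = [set u | (f u + (inner ls (A u - b))%:E <= (c + e_ n)%:E)%E]
        `&` ([set u | `|A u - b| <= e_ n] `&`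
             [set u | `|u| ^+ 2 <= `|xbar| ^+ 2 + e_ n]).
      by apply/seteqP; split => u; [case=> ? ? ?|case=> ? []].
    apply: closedI.
      exact: closed_sublevel.
    apply: closedI.
      apply: (@closed_comp _ _ (fun u => `|A u - b|) [set r | r <= e_ n]).
        by move=> u _; apply: cvg_norm; exact: Abc.
      exact: closed_le.
    apply: (@closed_comp _ _ (fun u : X => `|u| ^+ 2)
      [set r | r <= `|xbar| ^+ 2 + e_ n]).
      move=> u _; apply: (@continuous_comp _ _ _ (fun u : X => `|u|)
        (fun r => r ^+ 2)); last exact: exprn_continuous.
      exact: norm_continuous.
    exact: closed_le.
  - move=> n m /e_le nm u [h1 h2 h3]; split.
    + by rewrite (le_trans h1)// lee_fin lerD2l.
    + exact: le_trans h2 nm.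
    + by rewrite (le_trans h3)// lerD2l.
  - move=> n u v [u1 u2 u3] [v1 v2 v3].
    have mid : A (2^-1 *: (u + v)) - b = 2^-1 *: ((A u - b) + (A v - b)).
      rewrite linearZ linearD addrACA -opprD scalerBr; congr (_ - _).
      by rewrite -[in RHS](scale1r b) -scalerDl scalerA mulVf ?scale1r.
    split.
    + rewrite /lagrangian mid innerZr innerDr.
      move: u1 v1; rewrite /lagrangian -!leeBrDr// -!EFinB => u1 v1.
      have h2 : 0 <= (2^-1 : R) <= 1 by apply/andP; split; lra.
      have -> : 2^-1 *: (u + v) = 2^-1 *: u + (1 - 2^-1) *: v.
        by rewrite scalerDr; congr (_ + _ *: _); field.
      apply: (le_trans (convex_fun_le fconv h2 u1 v1)).
      by rewrite lee_fin; lra.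
    + rewrite mid normrZ ger0_norm ?invr_ge0//.
      have := ler_normD (A u - b) (A v - b); lra.
    + have := sqr_ge0 `|u - v|.
      by rewrite sqr_norm_half; lra.
  - move=> n; split.
    + by rewrite /lagrangian Axb subrr inner0r adde0 fbE lee_fin lerDl ltW.
    + by rewrite Axb subrr normr0 ltW.
    + by rewrite lerDl ltW.
  - move=> u Cu.
    have Au : A u = b.
      apply/eqP; rewrite -subr_eq0 -normr_eq0; apply/eqP.
      by apply: small => // n; have [] := Cu n.
    have fu : (f u <= f xbar)%E.
      rewrite fbE; apply/lee_addgt0Pr => r r0.
      have [n] := ltr_add_invr r0; rewrite !add0r => nr.
      have [+ _ _] := Cu n; rewrite /lagrangian Au subrr inner0r adde0.
      by move/le_trans; apply; rewrite -EFinD lee_fin lerD2l ltW.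
    have := xbproj u; rewrite !sub0r !normrN; apply; split => //.
      exact: le_lt_trans fu fxb.
    by move=> y /xbmin; exact: le_trans.
  - by move=> n u [].
exists (e_ n) => // u h1 h2 h3; apply: nball; split => //.
by rewrite EFinD -fbE.
Qed.

End SaddlePoint.

(** Scalar core of the one-step energy estimate. Here [v] stands for x_(k+1) - xbar and [d] for
    x_(k+1) - x_k. A name such as [gv] or [zd] is an inner product with one of them: [g]
    subgradient, [z] increment of [Z], [l] new multiplier, [s] saddle multiplier, [x] new iterate.
    [F] and [F'] are the old and new values of the objective, [c] the optimal one. *)
Lemma energy_step_scalar (R : realFieldType)
    (al be be' de ga mu ep c F F' gv gd zv zd vv dv dd lv ld sv sd xv xd
     n n' nb h h' : R) :
  0 < al -> 0 < be -> 0 < de -> 0 <= mu -> 0 <= ep ->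
  0 <= de * ga - 1 -> de * be' <= de * be + al * be ->
  h' = F' + sv - c -> h = F + (sv - sd) - c -> 0 <= h' -> 0 <= vv -> 0 <= dd ->
  xv = (n' + vv - nb) / 2 -> xd = (n' + dd - n) / 2 ->
  zv = - (al * be) * (gv + lv + ep * xv) - mu * de * be * dv ->
  zd = - (al * be) * (gd + ld + ep * xd) - mu * de * be * dd ->
  mu / 2 * vv <= c - F' + gv -> mu / 2 * dd <= F - F' + gd ->
  de ^+ 2 * be' * h' - de ^+ 2 * be * h
  + (de * zv + de ^+ 2 / al * zd + (1 - de * ga) * dv
     + (1 - de * ga) * (de / al) * dd)
  + (de * ga - 1) / 2 * (2 * dv - dd)
  + (de * al * be * (lv - sv) + de ^+ 2 * be * (ld - sd))
  + de ^+ 2 * mu / 2 * (be' * vv - be * (vv - 2 * dv + dd))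
  <= - (de * al * be * ep / 2 * (n' - nb)) - de ^+ 2 * be * ep / 2 * (n' - n).
Proof.
move=> al0 be0 de0 mu0 ep0 dg bg h'E hE h'0 vv0 dd0 xvE xdE zvE zdE H1 H2.
have -> : de ^+ 2 / al * zd = - (de ^+ 2 * be) * (gd + ld + ep * xd)
    - (de ^+ 3 * mu * be / al) * dd.
  by rewrite zdE; field; rewrite gt_eqF.
(* [P1] and [P2] weight the strong convexity inequalities so that [gv] and [gd] cancel; [P3] uses
   the growth condition on [be], [P4] the sign of [de * ga - 1]; [P5] and [P6] are surplus
   squares. *)
have P1 : 0 <= de * al * be * (c - F' + gv - mu / 2 * vv).
  by rewrite mulr_ge0 ?subr_ge0// !mulr_ge0// ltW.
have P2 : 0 <= de ^+ 2 * be * (F - F' + gd - mu / 2 * dd).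
  by rewrite mulr_ge0 ?subr_ge0// !mulr_ge0 ?exprn_ge0// ltW.
have P3 : 0 <= de * (h' + mu / 2 * vv) * (de * be + al * be - de * be').
  by rewrite mulr_ge0 ?subr_ge0// mulr_ge0 ?(ltW de0)// addr_ge0// mulr_ge0// divr_ge0.
have P4 : 0 <= (de * ga - 1) * (de / al + 2^-1) * dd.
  by rewrite !mulr_ge0// addr_ge0 ?invr_ge0// divr_ge0 ?ltW.
have P5 : 0 <= (de ^+ 3 * mu * be / al) * dd.
  by rewrite mulr_ge0// divr_ge0 ?(ltW al0)// !mulr_ge0 ?exprn_ge0// ltW.
have P6 : 0 <= de * al * be * ep / 2 * vv + de ^+ 2 * be * (ep + 2 * mu) / 2 * dd.
  have ? := ltW al0; have ? := ltW be0; have ? := ltW de0.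
  by rewrite addr_ge0// !mulr_ge0 ?exprn_ge0 ?invr_ge0// addr_ge0// mulr_ge0.
(* The quotients become atoms, so that [lra] only has to combine the inequalities linearly. *)
move: P4 P5; set q := de ^+ 3 * mu * be / al; set r := de / al => P4 P5.
rewrite zvE xvE xdE; move: P1 P2 P3 P6; rewrite h'E hE; lra.
Qed.

(** * One iteration of the algorithm and its energy *)

Section Iterates.
Context {R : realType} {X Y : hilbertType R}.
Context (f : X -> \bar R) (A : {linear X -> Y}) (b : Y).
Context (muf delta gamma : R) (alpha beta eps : nat -> R).
Context (x Z : nat -> X) (lambda : nat -> Y).
Hypotheses (A_cont : continuous A) (muf_ge0 : 0 <= muf) (f_S0 : S0 muf f).
Hypotheses (delta_gt0 : 0 < delta) (gamma_gt0 : 0 < gamma).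
Hypothesis beta_gt0 : forall k, (1 <= k)%N -> 0 < beta k.
Hypothesis alpha_gt0 : forall k, (1 <= k)%N -> 0 < alpha k.
Hypothesis algo :
  primal_dual_algorithm f A b muf delta gamma alpha beta eps x Z lambda.

Let Zd k := Z_delta delta gamma x Z k.

(** The [gamma] terms cancel, which leaves an extrapolation of the iterates. *)
Lemma Z_delta_next k : (1 <= k)%N ->
  Zd k.+1 = x k.+1 + (delta / alpha k) *: (x k.+1 - x k).
Proof.
move=> k1; have [_ _ _ /(_ k k1)[_ ZE _]] := algo.
apply: inner_inj => w; rewrite /Zd /Z_delta ZE !innerE.
by field; rewrite gt_eqF// alpha_gt0.
Qed.

(** The new multiplier is the one that appears in the gradient of the augmented Lagrangian at the
    new iterate. *)
Lemma lambda_next k : (1 <= k)%N ->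
  lambda k.+1 = lambda_tilde A b delta beta x lambda k +
    theta_ delta alpha beta k *: (A (x k.+1) - b).
Proof.
move=> k1; have [_ _ _ /(_ k k1)[_ _ ->]] := algo.
rewrite -/(Zd k.+1) Z_delta_next//.
rewrite [A (_ + _)]linearD [A (_ *: _)]linearZ [A (_ - _)]linearB /=.
apply: inner_inj => w; rewrite /lambda_tilde /theta_ !innerE.
by field; rewrite gt_eqF// alpha_gt0.
Qed.

(** Optimality condition of the subproblem, tested against [u] so that no adjoint appears. The
    choice of [x_tilde] makes eta (x_(k+1) - x_tilde) equal to the increment of [Z] plus muf delta
    beta_k (x_(k+1) - x_k). *)
Lemma iterate_subgradient k : (1 <= k)%N ->
  f (x k.+1) \is a fin_num /\ exists2 g, subdiff f (x k.+1) g &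
    forall u, inner (Z k.+1 - Z k) u =
      - (alpha k * beta k) *
        (inner g u + inner (lambda k.+1) (A u) + eps k * inner (x k.+1) u)
      - muf * delta * beta k * inner (x k.+1 - x k) u.
Proof.
move=> k1; have [f_proper _ _ f_conv _] := f_S0.
have [_ _ _ /(_ k k1)[pmin ZE _]] := algo.
have al0 := alpha_gt0 k1; have be0 := beta_gt0 k1.
set p := x k.+1; set eta := eta_ muf delta gamma alpha beta k.
set xt := x_tilde muf delta gamma alpha beta x Z k.
set lt := lambda_tilde A b delta beta x lambda k.
set th := theta_ delta alpha beta k.
have eta0 : 0 < eta.
  by rewrite /eta /eta_ ltr_wpDr ?addr_gt0 ?invr_gt0// !mulr_ge0// ltW.
have [Al AlE] := adjoint_exists (lambda k.+1) A_cont.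
pose w := Al + (eta / (alpha k * beta k)) *: (p - xt) + eps k *: p.
pose q u := inner lt (A u - b) + th / 2 * `|A u - b| ^+ 2 +
  (eta / (2 * alpha k * beta k) * `|u - xt| ^+ 2 + eps k / 2 * `|u| ^+ 2).
pose Q d := th / 2 * `|A d| ^+ 2 +
  (eta / (2 * alpha k * beta k) * `|d| ^+ 2 + eps k / 2 * `|d| ^+ 2).
have wE d : inner w d = inner (lambda k.+1) (A d) +
    eta / (alpha k * beta k) * inner (p - xt) d + eps k * inner p d.
  by rewrite /w 2!innerDl AlE !innerZl.
have qE d t : q (p + t *: d) = q p + t * inner w d + t ^+ 2 * Q d.
  have AE : A (p + t *: d) - b = (A p - b) + t *: A d.
    by rewrite linearD linearZ addrAC.
  have pE : p + t *: d - xt = (p - xt) + t *: d by rewrite addrAC.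
  rewrite /q /Q AE pE (sqr_normD (A p - b)) (sqr_normD (p - xt)).
  rewrite (sqr_normD p (t *: d)).
  rewrite !sqr_normZ.
  rewrite wE (lambda_next k1) -/lt -/th -/p (innerDl (A d)) innerZl.
  rewrite innerDr !innerZr.
  by field; rewrite !gt_eqF.
have [pfin sub] : f p \is a fin_num /\ subdiff f p (- w).
  apply: (argmin_add_quadratic f_proper f_conv qE) => u.
  have subE v : subproblem f A b muf delta gamma alpha beta eps x Z lambda k v =
      (f v + (q v)%:E)%E.
    by rewrite /subproblem /aug_lagrangian /lagrangian -!addeA /q !EFinD !addeA.
  by rewrite -!subE; exact: pmin.
split=> //; exists (- w) => // u.
have xtE : inner xt u = inner (x k) u + eta^-1 * (inner (Z k) u - gamma * inner (x k) u).
  by rewrite /xt /x_tilde !innerE.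
rewrite innerNl wE !innerBl xtE ZE innerBl !innerZl -/p.
have etaE : eta = gamma + (alpha k)^-1 + muf * delta * beta k by [].
have -> : eta / (alpha k * beta k) * (inner p u - (inner (x k) u + eta^-1 *
      (inner (Z k) u - gamma * inner (x k) u))) =
    (eta * (inner p u - inner (x k) u) - (inner (Z k) u - gamma * inner (x k) u))
      / (alpha k * beta k).
  by field; rewrite !gt_eqF.
rewrite etaE; field; rewrite !gt_eqF//.
Qed.

Context (ls : Y) (xbar : X).
Hypothesis beta_nondecr : forall k, (1 <= k)%N -> beta k <= beta k.+1.
Hypothesis delta_gamma : 0 <= delta * gamma - 1.
Hypothesis beta_growth : forall k, (1 <= k)%N ->
  delta * beta k.+1 <= delta * beta k + alpha k * beta k.
Hypothesis eps_ge0 : forall k, (1 <= k)%N -> 0 <= eps k.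
Hypothesis eps_nonincr : forall k, (1 <= k)%N -> eps k.+1 <= eps k.
Hypothesis Axbar : A xbar = b.
Hypothesis f_xbar_fin : f xbar \is a fin_num.
Hypothesis lagr_lb : forall u, (f xbar <= lagrangian f A b u ls)%E.

(** The excess h(x_k) as a real number; [fine] is faithful from k = 2 on, where [f (x k)] is
    finite. *)
Definition gap k :=
  fine (f (x k)) + inner ls (A (x k) - b) - fine (f xbar).

(* At [k = 1] the value [f (x 1)] may be infinite, so the energy is only used
   from [k = 2] on. *)
Definition energy k :=
  delta ^+ 2 * beta k * gap k + `|Zd k - xbar| ^+ 2 / 2
  + (delta * gamma - 1) / 2 * `|x k - xbar| ^+ 2
  + delta / 2 * `|lambda k - ls| ^+ 2
  + delta ^+ 2 * muf / 2 * (beta k * `|x k - xbar| ^+ 2).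

Definition tikhonov_energy r k :=
  energy k + delta ^+ 2 * (beta k * eps k) / 2 * (`|x k| ^+ 2 - r).

Lemma f_iterate_fin k : (2 <= k)%N -> f (x k) \is a fin_num.
Proof. by case: k => // k /iterate_subgradient[]. Qed.

Lemma lagrangian_gap k : (2 <= k)%N ->
  lagrangian f A b (x k) ls = (f xbar + (gap k)%:E)%E.
Proof.
move=> k2; rewrite /lagrangian /gap -(fineK (f_iterate_fin k2)) -(fineK f_xbar_fin).
by rewrite -!EFinD; congr _%:E; rewrite /=; ring.
Qed.

Lemma gap_ge0 k : (2 <= k)%N -> 0 <= gap k.
Proof.
move=> k2; have := lagr_lb (x k); rewrite lagrangian_gap//.
by rewrite -(fineK f_xbar_fin) -EFinD lee_fin lerDl.
Qed.

(** Squares are expanded around index [k.+1] by |a|^2 - |a - da|^2 = 2 <a, da> - |da|^2. The scalar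
    lemma bounds the cross terms; the squares of [du] and [dL] have the right sign and are
    dropped. *)
Lemma energy_step k : (2 <= k)%N -> energy k.+1 - energy k <=
  - (delta * alpha k * beta k * eps k / 2 * (`|x k.+1| ^+ 2 - `|xbar| ^+ 2))
  - delta ^+ 2 * beta k * eps k / 2 * (`|x k.+1| ^+ 2 - `|x k| ^+ 2).
Proof.
move=> k2; have k1 : (1 <= k)%N by exact: leq_trans k2.
have al0 := alpha_gt0 k1; have be0 := beta_gt0 k1.
have [f_proper _ _ _ sc] := f_S0.
have [pfin [g gsub ZE]] := iterate_subgradient k1.
have kfin := f_iterate_fin k2.
set p := x k.+1 in pfin gsub ZE *; set v := p - xbar; set d := p - x k.
have xE : x k - xbar = v - d by rewrite /v /d opprB addrAC addrCA subrr addr0 addrC.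
have H1 : muf / 2 * `|v| ^+ 2 <= fine (f xbar) - fine (f p) + inner g v.
  have := sc xbar p g gsub; rewrite -[f xbar]fineK// -[f p]fineK//.
  by rewrite -!EFinB lee_fin -(opprB p) -/v normrN innerNr opprK.
have H2 : muf / 2 * `|d| ^+ 2 <= fine (f (x k)) - fine (f p) + inner g d.
  have := sc (x k) p g gsub; rewrite -[f (x k)]fineK// -[f p]fineK//.
  by rewrite -!EFinB lee_fin -(opprB p) -/d normrN innerNr opprK.
have Av : A p - b = A v by rewrite /v linearB Axbar.
have Ax : A (x k) - b = A v - A d.
  by rewrite -Av /d [A (p - _)]linearB opprB [RHS]addrC subrKA.
set u' := v + (delta / alpha k) *: d.
have uE' : Zd k.+1 - xbar = u' by rewrite Z_delta_next// addrAC.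
pose du := delta *: (Z k.+1 - Z k) + (1 - delta * gamma) *: d.
have uE : Zd k - xbar = u' - du.
  rewrite -uE' /du /d; apply: inner_inj => w.
  by rewrite /Zd /Z_delta -/p !innerE; ring.
set L' := lambda k.+1 - ls.
pose dL := (alpha k * beta k) *: A u'.
have LE : lambda k - ls = L' - dL.
  have [_ _ _ /(_ k k1)[_ _ lE]] := algo.
  rewrite /L' lE -/(Zd k.+1) /dL -uE' [A (_ - xbar)]linearB Axbar.
  by rewrite [RHS]addrAC addrK.
have := @energy_step_scalar R (alpha k) (beta k) (beta k.+1) delta gamma muf
  (eps k) (fine (f xbar)) (fine (f (x k))) (fine (f p)) (inner g v) (inner g d)
  (inner (Z k.+1 - Z k) v) (inner (Z k.+1 - Z k) d) (`|v| ^+ 2) (inner d v)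
  (`|d| ^+ 2) (inner (lambda k.+1) (A v)) (inner (lambda k.+1) (A d))
  (inner ls (A v)) (inner ls (A d)) (inner p v) (inner p d) (`|x k| ^+ 2)
  (`|p| ^+ 2) (`|xbar| ^+ 2) (gap k) (gap k.+1) al0 be0 delta_gt0 muf_ge0
  (eps_ge0 k1) delta_gamma (beta_growth k1).
have h1 : gap k.+1 = fine (f p) + inner ls (A v) - fine (f xbar).
  by rewrite /gap -/p Av.
have h2 : gap k = fine (f (x k)) + (inner ls (A v) - inner ls (A d)) - fine (f xbar).
  by rewrite /gap Ax innerBr.
have h3 : inner p v = (`|p| ^+ 2 + `|v| ^+ 2 - `|xbar| ^+ 2) / 2.
  have -> : xbar = p - v by rewrite /v opprB addrC subrK.
  by rewrite sqr_normB; field.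
have h4 : inner p d = (`|p| ^+ 2 + `|d| ^+ 2 - `|x k| ^+ 2) / 2.
  have -> : x k = p - d by rewrite /d opprB addrC subrK.
  by rewrite sqr_normB; field.
have h5 := ZE v; have h6 := ZE d; rewrite -/d -sqr_norm_inner in h6.
move=> /(_ h1 h2 (gap_ge0 (leqW k2)) (sqr_ge0 _) (sqr_ge0 _) h3 h4).
rewrite -/d in h5.
move=> /(_ h5 h6 H1 H2); apply: le_trans.
rewrite /energy uE' uE -/p -/v xE -/L' LE.
rewrite (sqr_normB u' du) (sqr_normB v d) (sqr_normB L' dL).
have e1 : inner u' du = delta * inner (Z k.+1 - Z k) v +
    delta ^+ 2 / alpha k * inner (Z k.+1 - Z k) d +
    (1 - delta * gamma) * inner d v +
    (1 - delta * gamma) * (delta / alpha k) * `|d| ^+ 2.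
  have -> v0 d0 z0 r s t : inner (v0 + r *: d0) (s *: z0 + t *: d0) =
      s * inner z0 v0 + r * s * inner z0 d0 + t * inner d0 v0
        + t * r * `|d0| ^+ 2.
    rewrite !innerE sqr_norm_inner (innerC v0 z0) (innerC v0 d0) (innerC d0 z0).
    by ring.
  by field; rewrite gt_eqF.
have e2 : delta * inner L' dL =
    delta * alpha k * beta k * (inner (lambda k.+1) (A v) - inner ls (A v)) +
    delta ^+ 2 * beta k * (inner (lambda k.+1) (A d) - inner ls (A d)).
  rewrite /dL /u' [A _]linearD [A (_ *: _)]linearZ innerZr innerDr innerZr /L' !innerBl.
  by field; rewrite gt_eqF.
have := sqr_ge0 `|du|; have := mulr_ge0 (ltW delta_gt0) (sqr_ge0 `|dL|).
rewrite -e2 -e1 (innerC v d); lra.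
Qed.

(** Since |x_(k+1)|^2 - r >= 0, [P'] may replace [eps k.+1] by [eps k], and [P] may replace
    [delta * beta k.+1] by its growth bound. The extra alpha term turns |xbar|^2 - |x_(k+1)|^2 into
    |xbar|^2 - r. *)
Lemma tikhonov_energy_step r k : (2 <= k)%N -> r <= `|x k.+1| ^+ 2 ->
  tikhonov_energy r k.+1 <= tikhonov_energy r k +
    beta k * (alpha k * eps k) * (delta / 2 * (`|xbar| ^+ 2 - r)).
Proof.
move=> k2 rk; have k1 : (1 <= k)%N by exact: leq_trans k2.
have := energy_step k2; rewrite /tikhonov_energy.
set n' := `|x k.+1| ^+ 2 in rk *; set n := `|x k| ^+ 2; set nb := `|xbar| ^+ 2.
have P : 0 <= delta * eps k * (n' - r) *
    (delta * beta k + alpha k * beta k - delta * beta k.+1).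
  by rewrite !mulr_ge0 ?subr_ge0 ?beta_growth ?eps_ge0// ltW.
have P' : 0 <= delta ^+ 2 * (n' - r) * (beta k.+1 * (eps k - eps k.+1)).
  rewrite !mulr_ge0 ?subr_ge0 ?eps_nonincr// ?exprn_ge0// ltW//.
  exact: beta_gt0.
by move: (energy k.+1) (energy k) => E' E; lra.
Qed.


(** * Asymptotics of the gap, the residual and the norm *)

Hypothesis beta_pinfty : beta k @[k --> \oo] --> +oo.
Hypothesis alpha_eps_summable :
  (\sum_(1 <= k <oo) (alpha k * eps k)%:E < +oo)%E.
Hypothesis beta_eps_pinfty : beta k * eps k @[k --> \oo] --> +oo.

Lemma energy_ge k : (2 <= k)%N ->
  delta ^+ 2 * beta k * gap k + delta / 2 * `|lambda k - ls| ^+ 2 <= energy k.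
Proof.
move=> k2; have be0 : 0 < beta k by rewrite beta_gt0// (leq_trans _ k2).
have P1 : 0 <= (delta * gamma - 1) / 2 * `|x k - xbar| ^+ 2.
  by rewrite mulr_ge0 ?sqr_ge0// divr_ge0.
have P2 : 0 <= delta ^+ 2 * muf / 2 * (beta k * `|x k - xbar| ^+ 2).
  by rewrite !mulr_ge0 ?sqr_ge0// ltW.
have P3 := sqr_ge0 `|Zd k - xbar|.
rewrite /energy; lra.
Qed.

Lemma dual_term_ge0 k : 0 <= delta / 2 * `|lambda k - ls| ^+ 2.
Proof. by rewrite mulr_ge0 ?sqr_ge0// divr_ge0// ltW. Qed.

Lemma gap_term_ge0 k : (2 <= k)%N -> 0 <= delta ^+ 2 * beta k * gap k.
Proof.
move=> k2; have be0 : 0 < beta k by rewrite beta_gt0// (leq_trans _ k2).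
by rewrite mulr_ge0 ?gap_ge0// mulr_ge0 ?sqr_ge0// ltW.
Qed.

(** Telescoped bound for r = 0. Unlike the energy it is monotone, as [averaging_bound] demands; the
    term at j = 1 is a nonnegative surplus. *)
Definition energy_budget k := tikhonov_energy 0 2 +
  delta / 2 * `|xbar| ^+ 2 * \sum_(1 <= j < k) beta j * (alpha j * eps j).

Lemma weight_ge0 k : (1 <= k)%N -> 0 <= alpha k * eps k.
Proof. by move=> k1; rewrite mulr_ge0 ?eps_ge0// ltW// alpha_gt0. Qed.

Lemma energy_budget_nondecr k : (1 <= k)%N ->
  energy_budget k <= energy_budget k.+1.
Proof.
move=> k1; rewrite /energy_budget big_nat_recr//= lerD2l ler_wpM2l//.
  by rewrite mulr_ge0 ?sqr_ge0// divr_ge0// ltW.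
by rewrite lerDl mulr_ge0 ?weight_ge0// ltW// beta_gt0.
Qed.

Lemma tikhonov_energy_le_budget k : (2 <= k)%N ->
  tikhonov_energy 0 k <= energy_budget k.
Proof.
elim: k => // k IH; rewrite leq_eqVlt ltnS => /orP[/eqP <-|k2].
  rewrite /energy_budget lerDl mulr_ge0//.
    by rewrite mulr_ge0 ?sqr_ge0// divr_ge0// ltW.
  by rewrite big_nat1 mulr_ge0 ?weight_ge0// ltW// beta_gt0.
have := tikhonov_energy_step k2 (sqr_ge0 `|x k.+1|).
rewrite subr0 => /le_trans; apply.
have k1 : (1 <= k)%N by exact: leq_trans k2.
rewrite /energy_budget big_nat_recr//=.
by move: (IH k2); rewrite /energy_budget; lra.
Qed.

Lemma energy_le_budget k : (2 <= k)%N -> energy k <= energy_budget k.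
Proof.
move=> k2; apply: le_trans (tikhonov_energy_le_budget k2).
rewrite /tikhonov_energy lerDl subr0.
have k1 : (1 <= k)%N by exact: leq_trans k2.
by rewrite !mulr_ge0 ?sqr_ge0 ?eps_ge0// ltW// beta_gt0.
Qed.

Lemma energy_budget_little_o e : 0 < e ->
  \forall k \near \oo, energy_budget k <= e * beta k.
Proof.
move=> e0; set C := delta / 2 * `|xbar| ^+ 2.
(* [C] vanishes when [xbar] is 0, so [C + 1] is used as divisor. *)
have C1 : 0 < C + 1.
  by rewrite ltr_wpDl// mulr_ge0 ?sqr_ge0// divr_ge0// ltW.
have e2 : 0 < e / 2 / (C + 1) by rewrite !divr_gt0.
have sum_o := weighted_growth_little_o
  (G := fun k => \sum_(1 <= j < k) beta j * (alpha j * eps j)) weight_ge0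
  alpha_eps_summable (fun k k1 => ltW (beta_gt0 k1)) beta_nondecr beta_pinfty.
near=> k; have k1 : (1 <= k)%N by near: k; exact: nbhs_infty_ge.
have h1 : tikhonov_energy 0 2 / (e / 2) <= beta k.
  by near: k; move/cvgryPge : beta_pinfty; apply.
rewrite ler_pdivrMr ?divr_gt0// in h1.
have h2 : \sum_(1 <= j < k) beta j * (alpha j * eps j) <= e / 2 / (C + 1) * beta k.
  near: k; apply: sum_o => // k k1.
  by rewrite big_nat_recr.
rewrite /energy_budget -/C.
have h3 : 0 <= \sum_(1 <= j < k) beta j * (alpha j * eps j).
  rewrite big_nat_cond sumr_ge0// => j /andP[/andP[j1 _] _].
  by rewrite mulr_ge0 ?weight_ge0// ltW// beta_gt0.
have : (C + 1) * \sum_(1 <= j < k) beta j * (alpha j * eps j) <= e / 2 * beta k.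
  by rewrite mulrC -ler_pdivlMr// mulrAC.
by move: h3; set S := \sum_(_ <= _ < _) _; lra.
Unshelve. all: by end_near. Qed.

Lemma gap_eventually_le e : 0 < e -> \forall k \near \oo, gap k <= e.
Proof.
move=> e0; have d2 : 0 < delta ^+ 2 by rewrite exprn_gt0.
near=> k; have k2 : (2 <= k)%N by near: k; exact: nbhs_infty_ge.
have be0 : 0 < beta k by rewrite beta_gt0// (leq_trans _ k2).
have h : energy_budget k <= delta ^+ 2 * e * beta k.
  by near: k; apply: energy_budget_little_o; rewrite mulr_gt0.
rewrite -(ler_pM2l (mulr_gt0 d2 be0)).
have := energy_ge k2; have := energy_le_budget k2; have := dual_term_ge0 k; lra.
Unshelve. all: by end_near. Qed.

(* The residuals [delta beta_k (A x_k - b)] are averaged increments of the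
   multipliers, whose size is O(sqrt budget) = o(beta_k). *)
Lemma residual_eventually_le e : 0 < e ->
  \forall k \near \oo, `|A (x k) - b| <= e.
Proof.
move=> e0; pose s k := (delta * beta k) *: (A (x k) - b).
pose l k := lambda k - ls.
(* By [lambda_next], s_k plus the increment of [l] is (alpha_k + delta) beta_k (A x_(k+1) - b);
   [tau] rescales it to s_(k+1), and the growth condition gives tau <= 1. *)
pose tau k := delta * beta k.+1 / ((alpha k + delta) * beta k).
pose D k := Num.sqrt (2 / delta * energy_budget k).
have bound : forall k, (2 <= k)%N -> `|s k| <= `|s 2 - l 2| + 2 * D k.
  apply: (@averaging_bound _ _ s l tau D).
  - move=> k k2; have k1 : (1 <= k)%N by exact: leq_trans k2.
    have al0 := alpha_gt0 k1; have be0 := beta_gt0 k1.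
    have be'0 := beta_gt0 (leqW k1).
    rewrite /tau divr_ge0 ?ler_pdivrMr ?mul1r ?mulr_gt0 ?addr_gt0//=.
    + by rewrite mulrDl addrC beta_growth.
    + by rewrite ltW// mulr_gt0.
    + by rewrite ltW// !mulr_gt0 ?addr_gt0.
  - move=> k k2; rewrite ler_wsqrtr// ler_wpM2l ?divr_ge0 ?(ltW delta_gt0)//.
    by rewrite energy_budget_nondecr// (leq_trans _ k2).
  - move=> k k2; rewrite -[leLHS]ger0_norm// -sqrtr_sqr ler_wsqrtr//.
    rewrite mulrAC ler_pdivlMr//.
    have := energy_ge k2; have := energy_le_budget k2.
    have := gap_term_ge0 k2; rewrite -/(l k); lra.
  - move=> k k2; have k1 : (1 <= k)%N by exact: leq_trans k2.
    have al0 := alpha_gt0 k1; have be0 := beta_gt0 k1.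
    apply: inner_inj => w.
    rewrite /s /l /tau lambda_next// /lambda_tilde /theta_ !innerE.
    by field; rewrite !gt_eqF// addr_gt0.
have d4 : 0 < delta * e / 4 by rewrite !mulr_gt0.
near=> k; have k2 : (2 <= k)%N by near: k; exact: nbhs_infty_ge.
have be0 : 0 < beta k by rewrite beta_gt0// (leq_trans _ k2).
have be1 : 1 <= beta k by near: k; move/cvgryPge : beta_pinfty; apply.
have h : energy_budget k <= delta / 2 * (delta * e / 4) ^+ 2 * beta k.
  by near: k; apply: energy_budget_little_o; rewrite !mulr_gt0 ?exprn_gt0.
have h0 : `|s 2 - l 2| / (delta * e / 2) <= beta k.
  by near: k; move/cvgryPge : beta_pinfty; apply.
rewrite ler_pdivrMr ?divr_gt0 ?mulr_gt0// in h0.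
have hD : D k <= delta * e / 4 * beta k.
  rewrite -(ger0_norm (mulr_ge0 (ltW d4) (ltW be0))) -sqrtr_sqr.
  rewrite ler_wsqrtr// mulrAC ler_pdivrMr// exprMn.
  (* As beta_k >= 1, a budget of order o(beta_k) is also o(beta_k^2), so its square root is
     o(beta_k). *)
  have : beta k <= beta k ^+ 2 by rewrite expr2 ler_peMl// ltW.
  move=> /(ler_wpM2l (mulr_ge0 (ltW delta_gt0) (sqr_ge0 (delta * e / 4)))).
  lra.
have := bound k k2; rewrite /s normrZ gtr0_norm ?mulr_gt0// => hs.
rewrite -(ler_pM2l (mulr_gt0 delta_gt0 be0)); lra.
Unshelve. all: by end_near. Qed.

Lemma sqr_norm_eventually_le K e : 0 < e ->
  (forall k, (K <= k)%N -> `|xbar| <= `|x k|) ->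
  \forall k \near \oo, `|x k| ^+ 2 <= `|xbar| ^+ 2 + e.
Proof.
move=> e0 out; pose r := `|xbar| ^+ 2; pose N := maxn K 2.
have d2 : 0 < delta ^+ 2 by rewrite exprn_gt0.
have E_le n : tikhonov_energy r (N + n)%N <= tikhonov_energy r N.
  elim: n => [|n IH]; first by rewrite addn0.
  have N2 : (2 <= N + n)%N by rewrite (leq_trans (leq_maxr K 2))// leq_addr.
  have NK : (K <= (N + n).+1)%N.
    by rewrite (leq_trans (leq_maxl K 2))// leqW// leq_addr.
  rewrite addnS.
  have : r <= `|x (N + n).+1| ^+ 2 by rewrite lerXn2r ?nnegrE// out.
  move=> /(tikhonov_energy_step N2); rewrite subrr !mulr0 addr0.
  by move/le_trans; apply.
near=> k; have Nk : (N <= k)%N by near: k; exact: nbhs_infty_ge.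
have k2 : (2 <= k)%N by exact: leq_trans (leq_maxr K 2) Nk.
(* At this size, a norm violating the bound would make the regularisation term alone exceed the
   initial energy. *)
have h : (2 * `|tikhonov_energy r N| / delta ^+ 2 + 1) / e <= beta k * eps k.
  by near: k; move/cvgryPge : beta_eps_pinfty; apply.
rewrite leNgt; apply/negP => xk.
have := E_le (k - N)%N; rewrite subnKC// {1}/tikhonov_energy.
have := energy_ge k2; have := dual_term_ge0 k; have := gap_term_ge0 k2.
rewrite /energy -/r => h1 h2 h3 h4.
have h5 := ler_norm (tikhonov_energy r N).
rewrite ler_pdivrMr// in h.
have h6 : beta k * eps k * e <= beta k * eps k * (`|x k| ^+ 2 - r).
  have k1 : (1 <= k)%N by exact: leq_trans k2.
  rewrite ler_wpM2l//; last by rewrite lerBrDl ltW.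
  by rewrite mulr_ge0 ?eps_ge0// ltW// beta_gt0.
have := ler_wpM2l (ltW d2) (le_trans h h6).
rewrite mulrDr mulr1 mulrC divfK ?gt_eqF//; lra.
Unshelve. all: by end_near. Qed.

(** * Convergence to the minimal-norm solution *)

Hypothesis xbar_proj : metric_projection (solutions f A b) 0 xbar.

(** Gap and residual become small unconditionally. The norm bound stays a premise inside the filter,
    so that it can be supplied at all late indices or only along a subsequence. *)
Lemma distance_eventually_lt e : 0 < e -> exists2 d, 0 < d &
  \forall k \near \oo, `|x k| ^+ 2 <= `|xbar| ^+ 2 + d -> `|x k - xbar| < e.
Proof.
move=> e0; have [_ f_closed _ f_conv _] := f_S0.
have [d d0 wp] := min_norm_solution_well_posed A_cont f_closed f_conv
  f_xbar_fin lagr_lb xbar_proj e0.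
exists d => //; near=> k => xk.
have k2 : (2 <= k)%N by near: k; exact: nbhs_infty_ge.
apply: wp xk.
  rewrite lagrangian_gap// leeD2lE// lee_fin.
  by near: k; exact: gap_eventually_le.
by near: k; exact: residual_eventually_le.
Unshelve. all: by end_near. Qed.

Lemma distance_cvg0 :
  (forall d, 0 < d -> \forall k \near \oo, `|x k| ^+ 2 <= `|xbar| ^+ 2 + d) ->
  `|x k - xbar| @[k --> \oo] --> 0.
Proof.
move=> xle; apply/cvgrPdist_lt => e /distance_eventually_lt[d d0 xd].
near=> k; rewrite sub0r normrN normr_id.
have : `|x k| ^+ 2 <= `|xbar| ^+ 2 + d by near: k; exact: xle.
by near: k.
Unshelve. all: by end_near. Qed.

(** Either the iterates eventually stay outside the open ball, and the whole sequence converges, or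
    they enter it infinitely often, and the norm bound holds at those indices. *)
Lemma limn_einf_distance : limn_einf (fun k => `|x k - xbar|%:E) = 0%E.
Proof.
have [[K out]|/forallNP inside] :=
  pselect (exists K, forall k, (K <= k)%N -> `|xbar| <= `|x k|).
  have cvg0 : `|x k - xbar| @[k --> \oo] --> 0.
    by apply: distance_cvg0 => d d0; exact: sqr_norm_eventually_le out.
  have cvg0E : `|x k - xbar|%:E @[k --> \oo] --> 0%:E.
    by apply: cvg_EFin => //; exact: nearW.
  by have [-> _] := cvg_limn_einf_sup cvg0E.
apply: limn_einf_eq0 => // e /distance_eventually_lt[d d0 [N _ xd]] M.
have /existsNP[k /not_implyP[MNk /negP]] := inside (maxn M N).
rewrite -ltNge => xk; exists k; first exact: leq_trans (leq_maxl M N) MNk.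
apply: xd; first exact: leq_trans (leq_maxr M N) MNk.
by rewrite ler_wpDr ?(ltW d0)// lerXn2r ?nnegrE// ltW.
Qed.

Lemma distance_cvg0_of_ball K :
  (forall k, (K <= k)%N -> ball (0 : X) `|xbar| (x k)) \/
  (forall k, (K <= k)%N -> (~` ball (0 : X) `|xbar|) (x k)) ->
  `|x k - xbar| @[k --> \oo] --> 0.
Proof.
move=> inout; apply: distance_cvg0 => d d0; have [inside|outside] := inout.
  exists K => // k /= /inside; rewrite -ball_normE /= sub0r normrN => xk.
  by rewrite ler_wpDr ?(ltW d0)// lerXn2r ?nnegrE// ltW.
apply: (@sqr_norm_eventually_le K) => // k /outside.
by rewrite -ball_normE /= sub0r normrN => /negP; rewrite -leNgt.
Qed.

End Iterates.

Theorem corollary4 (R : realType) (X Y : hilbertType R)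
  (f : X -> \bar R) (A : {linear X -> Y}) (b : Y)
  (muf delta gamma : R) (alpha beta eps : nat -> R)
  (x Z : nat -> X) (lambda : nat -> Y)
  (xstar : X) (lambdastar : Y) (xbar : X)
  (A_cont : continuous A)
  (muf_ge0 : 0 <= muf)
  (f_S0 : S0 muf f)
  (delta_gt0 : 0 < delta) (gamma_gt0 : 0 < gamma)
  (beta_gt0 : forall k, (1 <= k)%N -> 0 < beta k)
  (beta_nondecr : forall k, (1 <= k)%N -> beta k <= beta k.+1)
  (beta_pinfty : beta k @[k --> \oo] --> +oo)
  (alpha_gt0 : forall k, (1 <= k)%N -> 0 < alpha k)
  (delta_gamma : 0 <= delta * gamma - 1)
  (beta_growth : forall k, (1 <= k)%N ->
     delta * beta k.+1 <= delta * beta k + alpha k * beta k)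
  (algo : primal_dual_algorithm f A b muf delta gamma alpha beta eps x Z lambda)
  (saddle : saddle_points f A b (xstar, lambdastar))
  (eps_ge0 : forall k, (1 <= k)%N -> 0 <= eps k)
  (eps_nonincr : forall k, (1 <= k)%N -> eps k.+1 <= eps k)
  (alpha_eps_summable :
     (\sum_(1 <= k <oo) (alpha k * eps k)%:E < +oo)%E)
  (beta_eps_pinfty : beta k * eps k @[k --> \oo] --> +oo)
  (xbar_proj : metric_projection (solutions f A b) 0 xbar) :
  limn_einf (fun k => `|x k - xbar|%:E) = 0%E
  /\ ((exists K : nat, (1 <= K)%N /\
        ((forall k, (K <= k)%N -> ball (0 : X) `|xbar| (x k)) \/
         (forall k, (K <= k)%N -> (~` ball (0 : X) `|xbar|) (x k)))) ->
      `|x k - xbar| @[k --> \oo] --> 0).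
Proof.
have [f_proper _ _ _ _] := f_S0.
have [sol _] := xbar_proj; have [Axbar _ _] := sol.
have [xbar_fin lagr_lb] := saddle_point_lower_bound f_proper saddle sol.
split; first exact: (limn_einf_distance A_cont muf_ge0 f_S0 delta_gt0 gamma_gt0
  beta_gt0 alpha_gt0 algo beta_nondecr delta_gamma beta_growth eps_ge0
  eps_nonincr Axbar xbar_fin lagr_lb).
move=> [K [_ inout]].
exact: (distance_cvg0_of_ball A_cont muf_ge0 f_S0 delta_gt0 gamma_gt0
  beta_gt0 alpha_gt0 algo beta_nondecr delta_gamma beta_growth eps_ge0
  eps_nonincr Axbar xbar_fin lagr_lb beta_pinfty alpha_eps_summable
  beta_eps_pinfty xbar_proj inout).
Qed.
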